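(* Let $p$ be an odd prime and $a,t\in\mathbb Z_p$ with $t\not\equiv 0\pmod p$. Then $$\begin{aligned}P_{2\langle a\rangle_p}(\sqrt t)&\equiv\sum_{k=0}^{p-1}\binom ak\binom{-\frac12-a}k(1-t)^k\equiv t^{\langle a\rangle_p}\sum_{k=0}^{p-1}\binom ak\binom{a-\frac12}k\Big(1-\frac1t\Big)^k\\&\equiv\Big(\frac tp\Big)t^{[\frac{2\langle a\rangle_p}{p}]}\sum_{k=0}^{p-1}\binom{-1-a}k\binom{a-\frac12}k(1-t)^k\\&\equiv\Big(\frac tp\Big)t^{[\frac{2\langle a\rangle_p}{p}]-\langle a\rangle_p}\sum_{k=0}^{p-1}\binom{-1-a}k\binom{-\frac12-a}k\Big(1-\frac1t\Big)^k\pmod p.\end{aligned}$$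
   Context: For a prime $p$, $\mathbb Z_p$ is the set of rationals with denominator coprime to $p$; congruences mod $p$ between elements of $\mathbb Z_p$ mean the difference divided by $p$ lies in $\mathbb Z_p$. For $a\in\mathbb Z_p$, $\langle a\rangle_p\in\{0,1,\dots,p-1\}$ is defined by $a\equiv\langle a\rangle_p\pmod p$. $[x]$ is the floor of $x$. For rational $a$, $\binom ak=a(a-1)\cdots(a-k+1)/k!$. $\big(\frac tp\big)$ is the Legendre symbol. $P_n$ is the Legendre polynomial ($P_0=1,P_1=x,(n+1)P_{n+1}=(2n+1)xP_n-nP_{n-1}$); $P_{2n}(\sqrt t)$ is a polynomial in $t$, evaluated at $t$. *)

(* Defs.v *)
From HB Require Import structures.
From mathcomp Require Import all_boot all_order all_algebra.
From mathcomp Require Import zify ring.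

Set Implicit Arguments.
Unset Strict Implicit.
Unset Printing Implicit Defensive.

Import Order.TTheory GRing.Theory Num.Theory.

Local Open Scope ring_scope.

(* x \in Zloc p is membership in Z_p, the rationals whose reduced denominator
   is coprime to p. *)
Definition Zloc (p : nat) : pred rat := [pred x | coprime p `|denq x|%N].

Definition congp (p : nat) (x y : rat) : bool := (x - y) / p%:R \in Zloc p.

(* The residue <a>_p in {0, ..., p - 1}; it is the junk value 0 when a has no
   residue, which does not happen for a in Z_p (residuepP). *)
Definition residuep (p : nat) (a : rat) : nat :=
  if [pick r : 'I_p | congp p a (r : nat)%:R] is Some r then r else 0%N.

Definition gbinom (a : rat) (k : nat) : rat :=
  (\prod_(i < k) (a - i%:R)) / k`!%:R.

Definition legendre_symbol (p : nat) (t : rat) : int :=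
  if congp p t 0 then 0
  else if [exists x : 'I_p, congp p ((x : nat)%:R ^+ 2) t] then 1 else -1.

Fixpoint legendre_poly (n : nat) : {poly rat} :=
  if n is n'.+1 then
    if n' is m.+1 then
      m.+2%:R^-1 *: (m.*2.+3%:R *: ('X * legendre_poly n')
                     - m.+1%:R *: legendre_poly m)
    else 'X
  else 1.

(* The value P_{2n}(sqrt t): by legendre_poly_even, even_poly P_{2n} is the
   polynomial Q such that P_{2n}(X) = Q(X^2). *)
Definition legendre_even_at_sqrt (n : nat) (t : rat) : rat :=
  (even_poly (legendre_poly n.*2)).[t].

Lemma legendre_poly_rec n :
  n.+2%:R *: legendre_poly n.+2 =
  (2 * n.+1 + 1)%:R *: ('X * legendre_poly n.+1) - n.+1%:R *: legendre_poly n.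
Proof.
rewrite [legendre_poly n.+2]/= scalerA divff ?pnatr_eq0 // scale1r.
by have -> : (2 * n.+1 + 1 = n.*2.+3)%N by lia.
Qed.

Lemma legendre_poly_parity n :
  odd_poly (legendre_poly n.*2) = 0 /\ even_poly (legendre_poly n.*2.+1) = 0.
Proof.
elim: n => [|n [IHo IHe]].
  rewrite /= odd_polyC; split=> //; apply/polyP => i.
  by rewrite coef_even_poly coefX coef0; case: eqP => //; lia.
have Ho : odd_poly (legendre_poly n.+1.*2) = 0.
  rewrite doubleS [legendre_poly _]/= linearZ linearB /= !linearZ /= IHo.
  by rewrite mulrC odd_polyMX [even_poly _]IHe !(scaler0, oppr0, addr0).
split=> //; rewrite doubleS in Ho *.
have -> : legendre_poly n.*2.+3 = n.*2.+3%:R^-1 *: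
   (n.*2.+1.*2.+3%:R *: ('X * legendre_poly n.*2.+2)
    - n.*2.+2%:R *: legendre_poly n.*2.+1) by [].
rewrite linearZ linearB !linearZ /= IHe.
by rewrite mulrC even_polyMX [odd_poly _]Ho mul0r !(scaler0, oppr0, addr0).
Qed.

Lemma legendre_poly_even n :
  legendre_poly n.*2 = even_poly (legendre_poly n.*2) \Po 'X^2.
Proof.
rewrite -[LHS]poly_even_odd (legendre_poly_parity n).1.
by rewrite comp_poly0 mul0r addr0.
Qed.

Lemma Zloc_div (p : nat) (m d : int) :
  d != 0 -> coprime p `|d|%N -> m%:~R / d%:~R \in Zloc p.
Proof.
move=> d0 cpd; rewrite inE; set x : rat := _ / _.
have dvd : (`|denq x| %| `|d|)%N.
  have : numq x * d = m * denq x.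
    apply/eqP; rewrite -(eqr_int rat) !rmorphM /= numqE /x.
    by rewrite mulrAC divfK // intr_eq0.
  move/(congr1 absz); rewrite !abszM => e.
  have : (`|denq x| %| `|numq x| * `|d|)%N by rewrite e dvdn_mull.
  by rewrite Gauss_dvdr // coprime_sym coprime_num_den.
exact: coprime_dvdr dvd cpd.
Qed.

Lemma residuepP p a :
  prime p -> a \in Zloc p ->
  (residuep p a < p)%N /\ congp p a (residuep p a)%:R.
Proof.
move=> pp; rewrite inE => cpa; rewrite /residuep.
case: pickP => [r cr | none]; first by split=> //; apply: ltn_ord.
have p0 : (p%:Z != 0) by have := prime_gt0 pp; lia.
have [[u v] /= uv] : exists uv : int * int, uv.1 * p%:Z + uv.2 * denq a = 1.
  have /coprimezP [uv e] : coprimez p (denq a) by [].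
  by exists uv.
pose z := v * numq a.
have lt_r : (`|(z %% p)%Z| < p)%N.
  by have := modz_ge0 z p0; have := ltz_pmod z (_ : 0 < p%:Z); lia.
have := none (Ordinal lt_r).
rewrite /congp /=.
suff -> : (a - `|(z %% p)%Z|%:R) / p%:R =
          (numq a * u + (z %/ p)%Z * denq a)%:~R / (denq a)%:~R.
  by rewrite Zloc_div ?denq_eq0.
have -> : `|(z %% p)%Z|%:R = (z %% p)%Z%:~R :> rat.
  by rewrite -[in RHS](gez0_abs (modz_ge0 z p0)).
have -> : (z %% p)%Z = z - (z %/ p)%Z * p by have := divz_eq z p; lia.
have d0 : (denq a)%:~R != 0 :> rat by rewrite intr_eq0 denq_eq0.
have p0' : p%:R != 0 :> rat by rewrite pnatr_eq0 -lt0n prime_gt0.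
have uvQ : u%:~R * p%:R + v%:~R * (denq a)%:~R = 1 :> rat.
  by rewrite -[RHS]/(1%:~R) -uv rmorphD !rmorphM.
rewrite -[X in X - _](divq_num_den a) /z !(rmorphD, rmorphN, rmorphM) /=.
have -> : u%:~R = (1 - v%:~R * (denq a)%:~R) / p%:R :> rat.
  by rewrite -[X in X - _]uvQ addrK mulfK.
by field; rewrite d0 p0'.
Qed.

(* Main.v *)
(* Let r = <a>_p. The first sum is an exact expansion of P_{2r}(sqrt t) when
   a = r: by the three-term recurrence, P_{2n}(x) = 2F1(-n, n + 1/2; 1; 1 - x^2)
   and P_{2n+1}(x) = x 2F1(-n, n + 3/2; 1; 1 - x^2).  After reduction to F_p every
   parameter becomes a natural number below p, so the four sums are
   S(m, n; x) = sum_k C(m, k) C(n, k) x^k with m = r or p - 1 - r, and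
   n = s or p - 1 - s, where s = <-1/2 - a>_p.  They are linked by Pfaff's
   transformation S(m, n; 1 - x) = x^m S(m, -1 - n; 1 - 1/x), applied in either
   argument, and by Euler's criterion. *)
Require Import Defs.
From mathcomp Require Import all_boot all_order all_algebra all_field.
From mathcomp Require Import zify ring.

Set Implicit Arguments.
Unset Strict Implicit.
Unset Printing Implicit Defensive.

Import Order.TTheory GRing.Theory Num.Theory.
Local Open Scope ring_scope.

(** * Generalized binomials and the expansion of Legendre polynomials in 1 - x^2 *)

Lemma gbinom0 x : gbinom x 0 = 1.
Proof. by rewrite /gbinom big_ord0 divr1. Qed.

Lemma gbinomS x k : gbinom x k.+1 = gbinom x k * (x - k%:R) / k.+1%:R.
Proof.
rewrite /gbinom big_ord_recr /= factS natrM invfM.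
by rewrite -!mulrA; congr (_ * _); ring.
Qed.

Lemma gbinomSl x k : gbinom x k.+1 = x / k.+1%:R * gbinom (x - 1) k.
Proof.
rewrite /gbinom big_ord_recl factS natrM invfM subr0.
under eq_bigr => i _ do rewrite lift0 -natr1 opprD addrCA addrC.
by rewrite addrC mulrACA.
Qed.

Lemma gbinom_nat n k : gbinom n%:R k = 'C(n, k)%:R.
Proof.
elim: k n => [|k IHk] [|n]; rewrite ?gbinom0 ?bin0 //.
  by rewrite gbinomSl !mul0r.
have k0 : k.+1%:R != 0 :> rat by rewrite pnatr_eq0.
rewrite gbinomSl -{2}natr1 addrK IHk; apply: (mulfI k0).
by rewrite mulrA mulrCA divff // mulr1 -!natrM mul_bin_diag.
Qed.

(** Since C(-b, k) = (-1)^k (b)_k / k!, the two signs cancel and these are the coefficients of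
    2F1(-n, n + 1/2; 1; y) and 2F1(-n, n + 3/2; 1; y). *)
Definition legendre_even_coef n k := gbinom n%:R k * gbinom (- 2^-1 - n%:R) k.
Definition legendre_odd_coef n k :=
  gbinom n%:R k * gbinom (- (3%:R / 2%:R) - n%:R) k.

Definition legendre_even n : {poly rat} := \poly_(k < n.+1) legendre_even_coef n k.
Definition legendre_odd n : {poly rat} := \poly_(k < n.+1) legendre_odd_coef n k.

Lemma coef_legendre_even n k : (legendre_even n)`_k = legendre_even_coef n k.
Proof.
rewrite coef_poly ltnS; case: leqP => // lt_nk.
by rewrite /legendre_even_coef gbinom_nat bin_small // mul0r.
Qed.

Lemma coef_legendre_odd n k : (legendre_odd n)`_k = legendre_odd_coef n k.
Proof.
rewrite coef_poly ltnS; case: leqP => // lt_nk.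
by rewrite /legendre_odd_coef gbinom_nat bin_small // mul0r.
Qed.

(** This is the three-term recurrence for P_{2n+2} in the variable ['X] = 1 - x^2: the two factors x
    in x P_{2n+1} combine to x^2 = 1 - ['X]. Coefficientwise, every term is a rational multiple of
    one common product of two binomials. *)
Lemma legendre_even_rec n :
  n.*2.+2%:R *: legendre_even n.+1 =
  n.*2.*2.+3%:R *: ((1 - 'X) * legendre_odd n) - n.*2.+1%:R *: legendre_even n.
Proof.
apply/polyP => k; rewrite !(coefZ, coefB, mulrBl, mul1r, coefXM).
rewrite !(coef_legendre_even, coef_legendre_odd).
have -> : n.*2.+2%:R = 2 * n%:R + 2 :> rat by rewrite -?addnn; ring.
have -> : n.*2.*2.+3%:R = 4 * n%:R + 3 :> rat by rewrite -?addnn; ring.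
have -> : n.*2.+1%:R = 2 * n%:R + 1 :> rat by rewrite -?addnn; ring.
rewrite /legendre_even_coef /legendre_odd_coef -[n.+1%:R]natr1.
case: k => [|k] /=; first by rewrite !gbinom0; ring.
have k0 : k.+1%:R != 0 :> rat by rewrite pnatr_eq0.
rewrite (gbinomSl (n%:R + 1)) addrK (gbinomSl (- 2^-1 - n%:R)).
rewrite [gbinom n%:R k.+1]gbinomS.
have -> : - 2^-1 - (n%:R + 1) = - (3 / 2) - n%:R :> rat by field.
have -> : - 2^-1 - n%:R - 1 = - (3 / 2) - n%:R :> rat by field.
rewrite !gbinomS -natr1 in k0 *.
by field.
Qed.

(** The recurrence for P_{2n+3}, with a factor x cancelled throughout. *)
Lemma legendre_odd_rec n :
  n.*2.+3%:R *: legendre_odd n.+1 =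
  n.*2.*2.+1.+4%:R *: legendre_even n.+1 - n.*2.+2%:R *: legendre_odd n.
Proof.
apply/polyP => k; rewrite !(coefZ, coefB).
rewrite !(coef_legendre_even, coef_legendre_odd).
have -> : n.*2.+2%:R = 2 * n%:R + 2 :> rat by rewrite -?addnn; ring.
have -> : n.*2.*2.+1.+4%:R = 4 * n%:R + 5 :> rat by rewrite -?addnn; ring.
have -> : n.*2.+3%:R = 2 * n%:R + 3 :> rat by rewrite -?addnn; ring.
rewrite /legendre_even_coef /legendre_odd_coef -[n.+1%:R]natr1.
case: k => [|k] /=; first by rewrite !gbinom0; ring.
have k0 : k.+1%:R != 0 :> rat by rewrite pnatr_eq0.
have -> : - 2^-1 - (n%:R + 1) = - (3 / 2) - n%:R :> rat by field.
have -> : - (3 / 2) - (n%:R + 1) = - (3 / 2) - n%:R - 1 :> rat by field.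
rewrite (gbinomSl (n%:R + 1)) addrK (gbinomSl (- (3 / 2) - n%:R)).
rewrite !gbinomS -natr1 in k0 *.
by field.
Qed.

Lemma legendre_polyE n :
  legendre_poly n.*2 = legendre_even n \Po (1 - 'X^2) /\
  legendre_poly n.*2.+1 = 'X * (legendre_odd n \Po (1 - 'X^2)).
Proof.
have natI m (p q : {poly rat}) : m.+1%:R *: p = m.+1%:R *: q -> p = q.
  move=> e; have m0 : m.+1%:R != 0 :> rat by rewrite pnatr_eq0.
  by rewrite -[p]scale1r -(mulVf m0) -scalerA e scalerA mulVf // scale1r.
elim: n => [|n [IHe IHo]].
  have e1 : legendre_even 0 = 1.
    apply/polyP=> k; rewrite coef_poly coef1; case: k => //.
    by rewrite /legendre_even_coef !gbinom0 mulr1.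
  have o1 : legendre_odd 0 = 1.
    apply/polyP=> k; rewrite coef_poly coef1; case: k => //.
    by rewrite /legendre_odd_coef !gbinom0 mulr1.
  by rewrite e1 o1 !comp_polyC mulr1.
have He : legendre_poly n.*2.+2 = legendre_even n.+1 \Po (1 - 'X^2).
  apply: (natI n.*2.+1); rewrite legendre_poly_rec IHe IHo -[RHS]comp_polyZ legendre_even_rec.
  rewrite comp_polyB !comp_polyZ comp_polyM comp_polyB comp_polyX comp_polyC.
  rewrite subKr mulrA -expr2.
  by congr (_ *: _ - _); congr (_%:R); lia.
split; first by rewrite doubleS.
rewrite doubleS; apply: (natI n.*2.+2); rewrite legendre_poly_rec IHo He.
rewrite [RHS]scalerAr -[X in _ = _ * X]comp_polyZ legendre_odd_rec.
rewrite comp_polyB !comp_polyZ mulrBr -!scalerAr.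
by congr (_ *: _ - _); congr (_%:R); lia.
Qed.

(** The free bound [N] lets the sum run up to p - 1: the terms with k > n vanish. *)
Lemma legendre_even_at_sqrtE n t N : (n < N)%N ->
  legendre_even_at_sqrt n t =
  \sum_(0 <= k < N) gbinom n%:R k * gbinom (- 2^-1 - n%:R) k * (1 - t) ^+ k.
Proof.
move=> lt_nN; rewrite /legendre_even_at_sqrt (legendre_polyE n).1.
have -> : legendre_even n \Po (1 - 'X^2) =
    (legendre_even n \Po (1 - 'X)) \Po 'X^2.
  by rewrite -comp_polyA comp_polyB comp_polyX comp_polyC.
have -> (q : {poly rat}) : even_poly (q \Po 'X^2) = q.
  apply/polyP => i; rewrite coef_even_poly coef_comp_poly_Xn // -muln2.
  by rewrite dvdn_mull // mulnK.
rewrite horner_comp !hornerE.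
rewrite (@horner_coef_wide _ N) ?(leq_trans (size_poly _ _)) //.
by rewrite big_mkord; apply: eq_bigr => i _; rewrite coef_legendre_even.
Qed.

(** * Pfaff's transformation as a binomial identity over a commutative ring *)

Lemma sum_binS (R : nzSemiRingType) m (h : nat -> R) :
  \sum_(k < m.+2) 'C(m.+1, k)%:R * h k =
  \sum_(k < m.+1) 'C(m, k)%:R * (h k + h k.+1).
Proof.
rewrite big_ord_recl.
under eq_bigr => k _ do rewrite lift0 binS natrD mulrDl.
rewrite big_split /= addrA.
under [RHS]eq_bigr => k _ do rewrite mulrDr.
rewrite [RHS]big_split /=; congr (_ + _).
rewrite [X in _ + X = _]big_ord_recr /= (@bin_small m m.+1) // mul0r addr0 [RHS]big_ord_recl /= bin0.
by congr (_ + _); rewrite ?bin0.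
Qed.

(* With E the shift and D = E - 1, this is (1 - x + x E)^m = (1 + x D)^m;
   [g j] plays the role of the j-th difference of [g 0]. *)
Lemma binomial_difference (R : comNzRingType) (g : nat -> nat -> R) x m j i :
  (forall j k, g j k.+1 = g j k + g j.+1 k) ->
  \sum_(k < m.+1) 'C(m, k)%:R * ((1 - x) ^+ (m - k) * x ^+ k * g j (i + k)%N) =
  \sum_(k < m.+1) 'C(m, k)%:R * (x ^+ k * g (j + k)%N i).
Proof.
move=> gS; elim: m i => [|m IHm] i.
  by rewrite !big_ord1 /= !addn0 !expr0 !mul1r.
rewrite (sum_binS _ (fun k => (1 - x) ^+ (m.+1 - k) * x ^+ k * g j (i + k)%N)).
rewrite (sum_binS _ (fun k => x ^+ k * g (j + k)%N i)).
transitivity ((1 - x) * \sum_(k < m.+1) 'C(m, k)%:R * (x ^+ k * g (j + k)%N i)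
  + x * \sum_(k < m.+1) 'C(m, k)%:R * (x ^+ k * g (j + k)%N i.+1)).
  rewrite -!IHm !mulr_sumr -big_split /=; apply: eq_bigr => k _.
  rewrite subSn ?subSS; last by rewrite -ltnS.
  by rewrite addnS addSn !exprS; ring.
rewrite !mulr_sumr -big_split /=; apply: eq_bigr => k _.
by rewrite gS addnS exprS; ring.
Qed.

Lemma pfaff_binomial (R : comNzRingType) (x : R) m n :
  \sum_(k < m.+1) 'C(m, k)%:R * ((1 - x) ^+ (m - k) * x ^+ k * 'C(n + k, k)%:R) =
  \sum_(k < m.+1) 'C(m, k)%:R * (x ^+ k * 'C(n, k)%:R).
Proof.
(* By Pascal's rule, raising j takes the difference in k. The two edges of this table are [g 0 k] =
   C(n + k, k) and [g k 0] = C(n, k). *)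
pose g j k : R := 'C(n + k, k + j)%:R.
have gS j k : g j k.+1 = g j k + g j.+1 k.
  by rewrite /g !addnS addSn binS natrD addrC.
have := binomial_difference x m 0 0 gS.
under [in LHS]eq_bigr => k _ do rewrite /g addn0 add0n.
by under [in RHS]eq_bigr => k _ do rewrite /g addn0 !add0n.
Qed.


(** * Binomials and their sums in the prime field *)

Lemma natr_Fp_eq0 p n : prime p -> (n%:R == 0 :> 'F_p) = (p %| n)%N.
Proof. by move=> pr_p; rewrite (dvdn_pcharf (pchar_Fp pr_p)). Qed.

Lemma intr_Fp_neq0 p (d : int) :
  prime p -> (d%:~R != 0 :> 'F_p) = coprime p `|d|%N.
Proof. by move=> pr_p; rewrite -(dvdz_pcharf (pchar_Fp pr_p)) prime_coprime. Qed.

Lemma fact_Fp_neq0 p k : prime p -> (k < p)%N -> k`!%:R != 0 :> 'F_p.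
Proof.
move=> pr_p; elim: k => [|k IHk] lt_kp; first by rewrite oner_eq0.
by rewrite factS natrM mulf_neq0 ?IHk 1?ltnW // natr_Fp_eq0 // gtnNdvd.
Qed.

Lemma expf_Fp_pred p (x : 'F_p) : prime p -> x != 0 -> x ^+ p.-1 = 1.
Proof.
move=> pr_p x0; apply: (mulfI x0); rewrite -exprS prednK ?prime_gt0 // mulr1.
by have := expf_card x; rewrite card_Fp.
Qed.

(** Over ['F_p] the value is meaningful only for k < p; beyond that k! is zero and the quotient
    takes the default value 0. *)
Definition fbinom (F : fieldType) (x : F) k :=
  (\prod_(i < k) (x - i%:R)) / k`!%:R.

Lemma fbinom_nat p n k :
  prime p -> (k < p)%N -> fbinom (n%:R : 'F_p) k = 'C(n, k)%:R.
Proof.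
move=> pr_p lt_kp; apply: (canLR (mulfK (fact_Fp_neq0 pr_p lt_kp))).
rewrite -natrM bin_ffact; elim: {lt_kp}k => [|k IHk]; first by rewrite big_ord0.
rewrite big_ord_recr /= IHk ffactnSr natrM.
have [le_kn | lt_nk] := leqP k n; first by rewrite natrB.
by rewrite ffact_small ?mul0r.
Qed.

(** Negating each factor turns the product into (-1)^k (n + 1)...(n + k). *)
Lemma fbinom_negS p n k : prime p -> (k < p)%N ->
  fbinom (- 1 - n%:R : 'F_p) k = (- 1) ^+ k * 'C(n + k, k)%:R.
Proof.
move=> pr_p lt_kp; apply: (canLR (mulfK (fact_Fp_neq0 pr_p lt_kp))).
rewrite -mulrA -natrM bin_ffact.
elim: {lt_kp}k => [|k IHk]; first by rewrite big_ord0 mulr1.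
rewrite big_ord_recr /= IHk addnS ffactnS natrM /= -natr1 natrD exprS.
ring.
Qed.

Definition binom_sum (p : nat) m n (x : 'F_p) : 'F_p :=
  \sum_(0 <= k < p) 'C(m, k)%:R * 'C(n, k)%:R * x ^+ k.

Lemma binom_sumC p m n (x : 'F_p) : binom_sum m n x = binom_sum n m x.
Proof. by apply: eq_bigr => k _; rewrite [X in X * _]mulrC. Qed.

Lemma sum_bin_trunc (R : nzSemiRingType) m N (h : nat -> R) : (m < N)%N ->
  \sum_(0 <= k < N) 'C(m, k)%:R * h k = \sum_(k < m.+1) 'C(m, k)%:R * h k.
Proof.
move=> lt_mN; rewrite (@big_cat_nat _ _ _ m.+1) //= big_mkord.
rewrite [X in _ + X]big_nat [X in _ + X]big1 ?addr0 // => k /andP[lt_mk _].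
by rewrite bin_small // mul0r.
Qed.

(* Pfaff's transformation for 2F1(-m, -n; 1; 1 - x). *)
Lemma binom_sum_pfaff p m n n' (x : 'F_p) :
  prime p -> (m < p)%N -> n'%:R = - 1 - n%:R :> 'F_p -> x != 0 ->
  binom_sum m n (1 - x) = x ^+ m * binom_sum m n' (1 - x^-1).
Proof.
move=> pr_p lt_mp n'E x0; rewrite /binom_sum.
under eq_bigr => k _ do rewrite -mulrA [X in _ * X]mulrC.
rewrite sum_bin_trunc // -pfaff_binomial.
under [in RHS]eq_bigr => k _ do rewrite -mulrA.
rewrite sum_bin_trunc // mulr_sumr; apply: eq_bigr => k _.
have le_km : (k <= m)%N by rewrite -ltnS.
have lt_kp : (k < p)%N by apply: leq_ltn_trans lt_mp.
(* The binomial identity was used at 1 - x, so its factor 1 - (1 - x) is x. On the other side C(n',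
   k) becomes (-1)^k C(n + k, k), and this sign cancels the one in 1 - 1/x = -(1 - x)/x. *)
rewrite -(fbinom_nat n' pr_p) // n'E fbinom_negS // subKr.
have -> : x ^+ m = x ^+ (m - k) * x ^+ k by rewrite -exprD subnK.
have -> : 1 - x^-1 = - 1 * (1 - x) / x by field.
rewrite !exprMn exprVn.
have xk0 : x ^+ k != 0 by rewrite expf_neq0.
have s1 : (-1) ^+ k * (-1) ^+ k = 1 :> 'F_p.
  by rewrite -exprMn mulrNN mulr1 expr1n.
transitivity ('C(m, k)%:R * (x ^+ (m - k) * (1 - x) ^+ k * 'C(n + k, k)%:R) *
  ((-1) ^+ k * (-1) ^+ k) * (x ^+ k / x ^+ k)); last by ring.
by rewrite s1 divff // !mulr1.
Qed.

(** * Reduction of p-integral rationals to the prime field *)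

(* A relation instead of a function on rat, so that closure under the field
   operations needs no reduced fractions; u is determined by x
   (reduces_unique). *)
Definition reduces (p : nat) (x : rat) (u : 'F_p) :=
  exists n d : int,
    [/\ d%:~R != 0 :> 'F_p, x = n%:~R / d%:~R & u = n%:~R / d%:~R].
Arguments reduces : clear implicits.

Lemma intr_Fp_neq0_rat (p : nat) (d : int) : d%:~R != 0 :> 'F_p -> d%:~R != 0 :> rat.
Proof. by rewrite intr_eq0; apply: contraNneq => ->. Qed.

Lemma reduces_int (p : nat) (z : int) : reduces p z%:~R z%:~R.
Proof. by exists z, 1; rewrite oner_eq0 !divr1. Qed.

Lemma reduces_nat p n : reduces p n%:R n%:R.
Proof. exact: (reduces_int p n). Qed.

Lemma reducesD (p : nat) x y u v :
  reduces p x u -> reduces p y v -> reduces p (x + y) (u + v).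
Proof.
move=> [n [d [d0 -> ->]]] [m [e [e0 -> ->]]].
have [d0' e0'] := (intr_Fp_neq0_rat d0, intr_Fp_neq0_rat e0).
exists (n * e + m * d), (d * e); rewrite !(rmorphD, rmorphM) /= mulf_neq0 //.
by rewrite !addf_div.
Qed.

Lemma reducesM (p : nat) x y u v :
  reduces p x u -> reduces p y v -> reduces p (x * y) (u * v).
Proof.
move=> [n [d [d0 -> ->]]] [m [e [e0 -> ->]]].
exists (n * m), (d * e); rewrite !rmorphM /= mulf_neq0 //.
by rewrite !mulf_div.
Qed.

Lemma reducesN (p : nat) x u : reduces p x u -> reduces p (- x) (- u).
Proof.
by move=> xu; rewrite -mulN1r -[- u]mulN1r; apply: reducesM => //;
  exact: (reduces_int p (-1)).
Qed.

Lemma reducesB (p : nat) x y u v :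
  reduces p x u -> reduces p y v -> reduces p (x - y) (u - v).
Proof. by move=> xu /reducesN; apply: reducesD. Qed.

Lemma reducesV (p : nat) x u : u != 0 -> reduces p x u -> reduces p x^-1 u^-1.
Proof.
move=> u0 [n [d [d0 -> uE]]]; exists d, n; rewrite uE !invf_div.
by move: u0; rewrite uE mulf_eq0 negb_or => /andP[].
Qed.

Lemma reducesX (p : nat) x u n : reduces p x u -> reduces p (x ^+ n) (u ^+ n).
Proof.
move=> xu; elim: n => [|n IHn]; first exact: (reduces_nat p 1).
by rewrite !exprS; apply: reducesM.
Qed.

Lemma reduces_unique p x u v : reduces p x u -> reduces p x v -> u = v.
Proof.
move=> [n [d [d0 -> ->]]] [m [e [e0 nm ->]]].
have [d0' e0'] := (intr_Fp_neq0_rat d0, intr_Fp_neq0_rat e0).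
apply/eqP; rewrite eqr_div // -!rmorphM.
by move/eqP: nm; rewrite eqr_div // -!rmorphM eqr_int => /eqP ->.
Qed.

Lemma Zloc_reduces p x : prime p -> x \in Zloc p -> exists u, reduces p x u.
Proof.
move=> pr_p; rewrite inE -intr_Fp_neq0 // => d0.
by eexists; exists (numq x), (denq x); split; rewrite // divq_num_den.
Qed.

(** Turns congruences into equalities in ['F_p]. If (x - y)/p reduces to q, then x - y reduces to p
    q = 0; conversely, a difference reducing to 0 has a numerator divisible by p. *)
Lemma congp_reduces p x y u v : prime p ->
  reduces p x u -> reduces p y v -> congp p x y = (u == v).
Proof.
move=> pr_p xu yv; rewrite /congp -subr_eq0; have := reducesB xu yv.
set z := x - y; set w := u - v => zw.
have p0 : p%:R != 0 :> rat by rewrite pnatr_eq0 -lt0n prime_gt0.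
apply/idP/eqP => [/(Zloc_reduces pr_p)[q /(reducesM (reduces_nat p p))]|].
  by rewrite mulrC divfK // pchar_Fp_0 // mul0r => /(reduces_unique zw).
case: zw => n [d [d0 -> ->]] /eqP; rewrite mulf_eq0 invr_eq0 (negPf d0) orbF.
rewrite -(dvdz_pcharf (pchar_Fp pr_p)) => /dvdzP[c ->].
rewrite rmorphM /= mulrAC mulfK // Zloc_div -?intr_Fp_neq0 //.
by have := intr_Fp_neq0_rat d0; rewrite intr_eq0.
Qed.

Lemma reduces_gbinom p x n k : prime p -> (k < p)%N ->
  reduces p x n%:R -> reduces p (gbinom x k) 'C(n, k)%:R.
Proof.
move=> pr_p lt_kp xn; rewrite -fbinom_nat //.
apply: reducesM; last first.
  by apply: reducesV; [apply: fact_Fp_neq0 | apply: reduces_nat].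
elim: {lt_kp}k => [|k IHk]; first by rewrite !big_ord0; apply: (reduces_nat p 1).
rewrite !big_ord_recr /=; apply: reducesM => //.
by apply: reducesB => //; apply: reduces_nat.
Qed.

Lemma reduces_gbinom_sum p x y z m n v : prime p ->
  reduces p x m%:R -> reduces p y n%:R -> reduces p z v ->
  reduces p (\sum_(0 <= k < p) gbinom x k * gbinom y k * z ^+ k)
            (binom_sum m n v).
Proof.
move=> pr_p xm yn zv; rewrite /binom_sum !big_mkord.
apply: (big_ind2 (reduces p)) => [|????|k _]; first exact: (reduces_nat p 0).
  exact: reducesD.
by do 2?apply: reducesM; try apply: reduces_gbinom; try apply: reducesX.
Qed.

(** * Euler's criterion *)

(* The squares of 1, ..., p./2 already exhaust the roots of X^(p./2) - 1. *)
Lemma expf_half_eq1 p (x : 'F_p) : prime p -> odd p -> x ^+ p./2 = 1 ->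
  exists2 i, (i < p)%N & i%:R ^+ 2 = x.
Proof.
move=> pr_p odd_p xh; pose h := p./2.
have pE : (p = h.*2.+1)%N by rewrite -[p]odd_double_half odd_p.
have h0 : (0 < h)%N by have := prime_gt1 pr_p; lia.
pose s := [seq (i%:R : 'F_p) ^+ 2 | i <- iota 1 h].
have [/mapP[i + ->]|xs] := boolP (x \in s).
  by rewrite mem_iota => ii; exists i => //; lia.
have us : uniq s.
  rewrite map_inj_in_uniq ?iota_uniq // => i j; rewrite !mem_iota => ih jh.
  wlog le_ij : i j ih jh / (i <= j)%N => [th|/eqP].
    by move=> e; case/orP: (leq_total i j) => le; [|symmetry]; apply: th.
  (* Equal squares force p to divide j - i or j + i. Both are below p, as i and j are at most (p -
     1)/2, and j + i is positive. *)
  rewrite eq_sym eqf_sqr -subr_eq0 -addr_eq0 -natrB // -natrD !natr_Fp_eq0 //.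
  case/orP => [|/dvdn_leq]; last by lia.
  have [|j_gt] := posnP (j - i)%N; first by lia.
  by move/(dvdn_leq j_gt); lia.
(* If x were not among these squares, X^h - 1 would have h + 1 distinct roots. *)
have rs : all (root ('X^h - 1%:P)) (x :: s).
  rewrite /= /root !hornerE xh subrr eqxx /=; apply/allP => _ /mapP[i + ->].
  rewrite mem_iota => ih; rewrite /root !hornerE -exprM.
  have -> : (2 * h = p.-1)%N by lia.
  by rewrite expf_Fp_pred ?subrr // natr_Fp_eq0 // gtnNdvd //; lia.
have := max_poly_roots (monic_neq0 (monicXnsubC 1 h0)) rs.
by rewrite /= xs us size_XnsubC //= size_map size_iota ltnn => /(_ isT).
Qed.

(** For u nonzero, u^((p-1)/2) squares to 1 by Fermat. It is 1 when u is a square, again by Fermat,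
    and only then by [expf_half_eq1]; otherwise it is -1. *)
Lemma legendre_symbol_euler p t (u : 'F_p) : prime p -> odd p ->
  reduces p t u -> (legendre_symbol p t)%:~R = u ^+ p./2.
Proof.
move=> pr_p odd_p tu; rewrite /legendre_symbol.
have pE : (p = (p./2).*2.+1)%N by rewrite -[LHS]odd_double_half odd_p.
rewrite (congp_reduces pr_p tu (reduces_nat p 0)).
have [->|u0] := eqVneq.
  by rewrite expr0n; have := prime_gt1 pr_p; case: p./2 pE => //=; lia.
have sqE i : congp p (i%:R ^+ 2) t = (i%:R ^+ 2 == u).
  by rewrite (congp_reduces pr_p (reducesX 2 (reduces_nat p i)) tu).
have sq1 : (u ^+ p./2) ^+ 2 = 1.
  by rewrite -exprM muln2 -[_.*2]/(_.*2.+1.-1) -pE expf_Fp_pred.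
case: existsP => [[x]|no_sq].
  rewrite sqE => /eqP uE; rewrite -uE -exprM mul2n -[_.*2]/(_.*2.+1.-1) -pE.
  by rewrite expf_Fp_pred //; apply: contraNneq u0 => x0; rewrite -uE x0 expr0n.
have /eqP := sq1; rewrite sqrf_eq1 => /orP[/eqP/expf_half_eq1|/eqP -> //].
case=> // i lt_ip iE; case: no_sq; exists (Ordinal lt_ip).
by rewrite sqE iE.
Qed.

(** * The chain of congruences *)

Theorem theorem2p2 (p : nat) (a t : rat)
    (hp : prime p) (hodd : odd p)
    (ha : a \in Zloc p) (ht : t \in Zloc p) (ht0 : ~~ congp p t 0) :
  let r := residuep p a in
  let f := ((2 * r) %/ p)%N in
  let e0 := legendre_even_at_sqrt r t in
  let e1 := \sum_(0 <= k < p)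
              gbinom a k * gbinom (- 2^-1 - a) k * (1 - t) ^+ k in
  let e2 := t ^+ r * \sum_(0 <= k < p)
              gbinom a k * gbinom (a - 2^-1) k * (1 - t^-1) ^+ k in
  let e3 := (legendre_symbol p t)%:~R * t ^+ f * \sum_(0 <= k < p)
              gbinom (- 1 - a) k * gbinom (a - 2^-1) k * (1 - t) ^+ k in
  let e4 := (legendre_symbol p t)%:~R * t ^ (f%:Z - r%:Z) * \sum_(0 <= k < p)
              gbinom (- 1 - a) k * gbinom (- 2^-1 - a) k * (1 - t^-1) ^+ k in
  [/\ congp p e0 e1, congp p e1 e2, congp p e2 e3 & congp p e3 e4].
Proof.
move=> r f e0 e1 e2 e3 e4.
have [lt_rp ar] := residuepP hp ha; rewrite -/r in lt_rp ar.
have {ha} [u au] := Zloc_reduces hp ha.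
move: ar; rewrite (congp_reduces hp au (reduces_nat p r)) => /eqP uE.
rewrite {u}uE in au.
have {ht} [x tx] := Zloc_reduces hp ht.
have x0 : x != 0 by rewrite -(congp_reduces hp tx (reduces_nat p 0)).
have p_gt1 := prime_gt1 hp.
pose h := p./2; have pE : (p = h.*2.+1)%N by rewrite -[LHS]odd_double_half hodd.
(* As 2r < 2p, the floor is 0 or 1, and it is 1 exactly when r exceeds h = (p - 1)/2. *)
have fE : f = (h < r)%N.
  rewrite /f; case: leqP => [le_rh | lt_hr]; first by rewrite divn_small //; lia.
  by apply/eqP; rewrite eqn_leq -ltnS ltn_divLR ?leq_divRL //; lia.
(* The residue of -1/2 - a: from 2h + 1 = p, h represents -1/2, and p is added exactly when h - r is
   negative. *)
pose s := (h + f * p - r)%N.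
have [lt_sp s_r] : (s < p)%N /\ (s + r = h + f * p)%N.
  by rewrite /s fE; case: leqP; lia.
have p0 : p%:R = 0 :> 'F_p by apply: pchar_Fp_0.
have two0 : 2 != 0 :> 'F_p by rewrite natr_Fp_eq0 // gtnNdvd //; lia.
have compl n : (n < p)%N -> (p - 1 - n)%:R = - 1 - n%:R :> 'F_p.
  by move=> lt_np; rewrite !natrB ?p0 ?sub0r //; lia.
have sE : s%:R = - 2^-1 - r%:R :> 'F_p.
  apply: (mulfI two0); rewrite mulrBr mulrN divff //.
  apply/eqP; rewrite eq_sym subr_eq -subr_eq0 -opprD oppr_eq0; apply/eqP.
  have -> : 1 + (2 * s%:R + 2 * r%:R) = (p + 2 * f * p)%:R :> 'F_p.
    have <- : (1 + (2 * s + 2 * r) = p + 2 * f * p)%N by lia.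
    by rewrite natrD natrD !natrM.
  by rewrite natrD natrM p0 mulr0 addr0.
(* The residues of -1 - a and a - 1/2. *)
pose r' := (p - 1 - r)%N; pose s' := (p - 1 - s)%N.
have half : reduces p 2^-1 2^-1 by apply: (reducesV two0 (reduces_nat p 2)).
have bs : reduces p (- 2^-1 - a) s%:R by rewrite sE; apply/reducesB/au/reducesN.
have as' : reduces p (a - 2^-1) s'%:R.
  rewrite compl // sE.
  have -> : - 1 - (- 2^-1 - r%:R) = r%:R - 2^-1 :> 'F_p by field.
  exact: reducesB.
have ar' : reduces p (- 1 - a) r'%:R.
  by rewrite compl //; apply/reducesB/au/reducesN/(reduces_nat p 1).
have t1 : reduces p (1 - t) (1 - x) by apply/reducesB/tx/(reduces_nat p 1).
have tV1 : reduces p (1 - t^-1) (1 - x^-1).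
  exact/reducesB/(reducesV x0 tx)/(reduces_nat p 1).
have leg : reduces p (legendre_symbol p t)%:~R (x ^+ h).
  by rewrite -(legendre_symbol_euler hp hodd tx); apply: reduces_int.
have t_neq0 : t != 0.
  apply: contraNneq ht0 => ->.
  by rewrite (congp_reduces hp (reduces_nat p 0) (reduces_nat p 0)).
(* [e0] is the first sum with a replaced by r; both parameters keep their residues, so [e0] and [e1]
   reduce to the same element. *)
have E0 : reduces p e0 (binom_sum r s (1 - x)).
  rewrite /e0 (legendre_even_at_sqrtE t lt_rp).
  apply: reduces_gbinom_sum => //; first exact: reduces_nat.
  by rewrite sE; apply/reducesB/(reduces_nat p r)/reducesN.
have E1 : reduces p e1 (binom_sum r s (1 - x)) by apply: reduces_gbinom_sum.
have E2 : reduces p e2 (x ^+ r * binom_sum r s' (1 - x^-1)).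
  by apply: reducesM; [apply: reducesX | apply: reduces_gbinom_sum].
have E3 : reduces p e3 (x ^+ h * x ^+ f * binom_sum r' s' (1 - x)).
  apply: reducesM; last exact: reduces_gbinom_sum.
  by apply: reducesM => //; apply: reducesX.
have E4 : reduces p e4 (x ^+ h * (x ^+ f / x ^+ r) * binom_sum r' s (1 - x^-1)).
  apply: reducesM; last exact: reduces_gbinom_sum.
  apply: reducesM => //; rewrite expfzDr // -exprnN.
  apply: reducesM; first exact: reducesX.
  by apply: reducesV; [rewrite expf_neq0 | apply: reducesX].
have lt_r'p : (r' < p)%N by rewrite /r'; lia.
have lt_s'p : (s' < p)%N by rewrite /s'; lia.
have xp : x ^+ h * x ^+ h = 1.
  by rewrite -exprD addnn -[h.*2]/(h.*2.+1.-1) -pE expf_Fp_pred.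
split.
- by rewrite (congp_reduces hp E0 E1).
- by rewrite (congp_reduces hp E1 E2) (@binom_sum_pfaff p r s s') // compl.
(* Pfaff with s' as the kept argument sends r' to r, leaving the powers of x to compare. *)
- rewrite (congp_reduces hp E2 E3) [binom_sum r' s' _]binom_sumC.
  rewrite (@binom_sum_pfaff p s' r' r) //; last first.
    by rewrite compl // subKr.
  rewrite mulrA binom_sumC; apply/eqP; congr (_ * _).
  rewrite -!exprD.
  (* Here s' = h + r - f p, so h + f + s' = r + (1 - f)(p - 1); the two cases are f = 0 and f =
     1. *)
  have [-> | ->] : (h + f + s' = r + p.-1 \/ h + f + s' = r)%N.
    by rewrite /s' /s fE; case: leqP; lia.
    by rewrite exprD expf_Fp_pred ?mulr1.
  by [].
(* Pfaff with r' kept sends s' to s; its factor x^r' is x^(-r), because r' + r = p - 1. *)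
- rewrite (congp_reduces hp E3 E4) (@binom_sum_pfaff p r' s' s) //; last first.
    by rewrite compl // subKr.
  rewrite mulrA; apply/eqP; congr (_ * _); rewrite -!mulrA; congr (_ * (_ * _)).
  apply: (mulIf (expf_neq0 r x0)); rewrite mulVf ?expf_neq0 // -exprD.
  by have -> : (r' + r = p.-1)%N; [rewrite /r'; lia | rewrite expf_Fp_pred].
Qed.
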